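(* The family of timelike cylindrical surfaces in $E_1^3$ forms a family of timelike similar ruled surfaces with variable transformation; that is, any two timelike cylindrical ruled surfaces of the same type in $E_1^3$ are timelike similar ruled surfaces with variable transformation.
   Context: $E_1^3$ is $\mathbb{R}^3$ with the Lorentz metric $\langle x,y\rangle=-x_1y_1+x_2y_2+x_3y_3$. A ruled surface is parametrized with its striction curve as base curve, $\vec c(s)+v\,\vec q(s)$, where $s$ is arc length of $\vec c$ and $\langle\vec q,\vec q\rangle=\varepsilon=\pm1$; its Frenet frame $\{\vec q,\vec h,\vec a\}$ (ruling, central normal = unit surface normal along the striction curve, asymptotic normal) is orthonormal. The surface is timelike if $\vec h$ is spacelike: of type $N_-$ if $\vec q$ is timelike, of type $N_+$ if $\vec q$ is spacelike. For timelike ruled surfaces the curvatures $k_1,k_2$ are defined by $\frac{d\vec q}{ds}=k_1\vec h$, $\frac{d\vec h}{ds}=-\varepsilon k_1\vec q+k_2\vec a$, $\frac{d\vec a}{ds}=\varepsilon k_2\vec h$. The ruled surface is cylindrical if the direction of $\vec q$ is constant, i.e. $k_1=0$. Definition: two regular timelike ruled surfaces of the same type, $\vec r_\alpha(s_\alpha,v_\alpha)=\vec\alpha(s_\alpha)+v_\alpha\vec q_\alpha(s_\alpha)$ and $\vec r_\beta(s_\beta,v_\beta)=\vec\beta(s_\beta)+v_\beta\vec q_\beta(s_\beta)$, with $\vec\alpha,\vec\beta$ their striction curves and $s_\alpha,s_\beta$ the arc lengths of these, are called timelike similar ruled surfaces with variable transformation $\lambda_\beta^\alpha$ if there exists a variable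 transformation $s_\alpha=\int\lambda_\beta^\alpha(s_\beta)\,ds_\beta$ of the arc lengths such that $\vec q_\alpha(s_\alpha)=\vec q_\beta(s_\beta)$ for all corresponding values of the parameters. All timelike ruled surfaces satisfying this relation are called a family of timelike similar ruled surfaces with variable transformation.
   Formalization: Literally false: cylinders with different constant rulings, e.g. (0,1,0) and (0,0,1) along (s,0,0), are not similar. Proved instead: any two timelike cylindrical surfaces of the same type are timelike similar after one is moved by a Lorentz isometry of E_1^3. *)

(* Defs.v *)
From mathcomp Require Import all_boot all_order all_algebra.
From mathcomp Require Import all_classical all_reals all_analysis.

Set Implicit Arguments.
Unset Strict Implicit.
Unset Printing Implicit Defensive.

Import Order.TTheory GRing.Theory Num.Theory.
Import numFieldNormedType.Exports.

Local Open Scope classical_set_scope.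
Local Open Scope ring_scope.

Definition lorentz (R : realType) (x y : 'rV[R]_3) : R :=
  - (x 0 0 * y 0 0) + x 0 1 * y 0 1 + x 0 2%:R * y 0 2%:R.

(* [Nminus]: timelike ruling; [Nplus]: spacelike ruling. *)
Inductive ruled_type := Nminus | Nplus.

Definition eps (R : realType) (t : ruled_type) : R :=
  match t with Nminus => -1 | Nplus => 1 end.

(* The ruled surface c(s) + v q(s) together with its Frenet apparatus.  Only
   the values of the functions on the parameter interval [dom] matter. *)
Record ruled_data (R : realType) := RuledData {
  rtype : ruled_type;
  dom : set R;
  striction : R -> 'rV[R]_3;
  ruling : R -> 'rV[R]_3;
  central_normal : R -> 'rV[R]_3;
  asymptotic_normal : R -> 'rV[R]_3;
  k1 : R -> R;
  k2 : R -> R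
}.

Definition surface (R : realType) (S : ruled_data R) (s v : R) : 'rV[R]_3 :=
  striction S s + v *: ruling S s.

Definition open_interval (R : realType) (I : set R) : Prop :=
  [/\ open I, is_interval I & I !=set0].

Definition C1_on (R : realType) (I : set R) (f : R -> 'rV[R]_3) : Prop :=
  forall s, I s -> derivable f s 1 /\ {for s, continuous (derive1 f)}.

Definition regular_surface (R : realType) (S : ruled_data R) : Prop :=
  forall s v, dom S s ->
    row_free (col_mx (derive1 (fun x => surface S x v) s)
                     (derive1 (fun y => surface S s y) v)).

(* The first equation says that s is arc length: the curve may be spacelike
   or timelike.  The last one makes the central normal normal to the surface
   along v = 0, where the tangent plane is spanned by c'(s) and q(s). *)
Definition striction_base (R : realType) (S : ruled_data R) : Prop :=
  forall s, dom S s ->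
    let c' := derive1 (striction S) s in
    [/\ `|lorentz c' c'| = 1,
        lorentz c' (derive1 (ruling S) s) = 0 &
        lorentz (central_normal S s) c' = 0].

(* <h,h> = 1 is the condition that the surface is timelike. *)
Definition timelike_frame (R : realType) (S : ruled_data R) : Prop :=
  forall s, dom S s ->
    let q := ruling S s in
    let h := central_normal S s in
    let a := asymptotic_normal S s in
    [/\ lorentz q q = eps R (rtype S), lorentz h h = 1
      & lorentz a a = - eps R (rtype S)] /\
    [/\ lorentz q h = 0, lorentz q a = 0 & lorentz h a = 0].

Definition frenet_equations (R : realType) (S : ruled_data R) : Prop :=
  forall s, dom S s ->
    let e := eps R (rtype S) in
    let q := ruling S in
    let h := central_normal S in
    let a := asymptotic_normal S in
    [/\ is_derive s 1 q (k1 S s *: h s),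
        is_derive s 1 h (- (e * k1 S s) *: q s + k2 S s *: a s) &
        is_derive s 1 a ((e * k2 S s) *: h s)].

Record timelike_ruled_surface (R : realType) (S : ruled_data R) : Prop :=
  TimelikeRuledSurface {
    trs_dom : open_interval (dom S);
    trs_C1 : C1_on (dom S) (striction S);
    trs_regular : regular_surface S;
    trs_striction : striction_base S;
    trs_frame : timelike_frame S;
    trs_frenet : frenet_equations S;
    trs_curvatures : forall s, dom S s ->
      {for s, continuous (k1 S)} /\ {for s, continuous (k2 S)}
  }.

Definition cylindrical (R : realType) (S : ruled_data R) : Prop :=
  forall s, dom S s -> k1 S s = 0.

(* s_alpha = phi s_beta is a primitive of lam, and a change of parameter from
   the interval J of s_beta onto the interval I of s_alpha. *)
Definition variable_transformation (R : realType) (I J : set R)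
    (phi lam : R -> R) : Prop :=
  set_bij J I phi /\
  forall s, J s ->
    [/\ is_derive s 1 phi (lam s), {for s, continuous lam} & lam s != 0].

Definition timelike_similar (R : realType) (A B : ruled_data R) : Prop :=
  [/\ timelike_ruled_surface A, timelike_ruled_surface B, rtype A = rtype B &
      exists phi lam : R -> R,
        variable_transformation (dom A) (dom B) phi lam /\
        forall s, dom B s -> ruling A (phi s) = ruling B s].

(* The motion x |-> x M + b of E_1^3, on row vectors. *)
Definition lorentz_isometry (R : realType) (M : 'M[R]_3) : Prop :=
  forall x y : 'rV[R]_3, lorentz (x *m M) (y *m M) = lorentz x y.

Definition move (R : realType) (M : 'M[R]_3) (b : 'rV[R]_3)
    (S : ruled_data R) : ruled_data R :=
  RuledData (rtype S) (dom S)
    (fun s => striction S s *m M + b)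
    (fun s => ruling S s *m M)
    (fun s => central_normal S s *m M)
    (fun s => asymptotic_normal S s *m M)
    (k1 S) (k2 S).

(* Main.v *)
Require Import Defs.
From mathcomp Require Import all_boot all_order all_algebra.
From mathcomp Require Import all_classical all_reals all_analysis.
From mathcomp Require Import ring lra.

Set Implicit Arguments.
Unset Strict Implicit.
Unset Printing Implicit Defensive.

Import Order.TTheory GRing.Theory Num.Theory.
Import numFieldNormedType.Exports.

Local Open Scope classical_set_scope.
Local Open Scope ring_scope.

(** The ruling of a cylindrical surface satisfies q' = k1 h = 0 on an interval,
    hence is constant ([cylindrical_ruling]).  Two surfaces of the same type
    then have constant rulings of the same causal character, which a Lorentz
    isometry matches: the Frenet frames of A and B at arbitrarily chosen
    parameters are bases with the same Gram matrix, diag(e, 1, -e), so the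
    linear map carrying one frame to the other preserves the Lorentz form
    ([gram_isometry], [gram_frame]).  A motion of E_1^3 carries a timelike ruled
    surface to a timelike ruled surface with the same parameter interval and
    the same curvatures ([move_timelike]).

    Once the rulings are equal constants, the condition q_A(phi s) = q_B(s)
    holds for every phi, and it only remains to find a variable transformation
    between the two parameter intervals.  Any two nonempty open intervals,
    bounded or not, are C^1-diffeomorphic: each of them is mapped to the half
    line of positive reals by an affine map, a homography or the exponential,
    and variable transformations can be composed and inverted
    ([open_interval_transformation]). *)

(** * Variable transformations between open intervals *)

Lemma set_bij_can (T U : Type) (A : set T) (B : set U) (f : T -> U)
    (g : U -> T) :
  (forall x, A x -> B (f x)) -> (forall y, B y -> A (g y)) ->
  (forall x, A x -> g (f x) = x) -> (forall y, B y -> f (g y) = y) ->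
  set_bij A B f.
Proof.
move=> fAB gBA fK gK; split => //.
- by move=> x y /set_mem Ax /set_mem Ay fxy; rewrite -(fK x)// fxy fK.
- by move=> y By; exists (g y); [exact: gBA|exact: gK].
Qed.

Lemma derivable1_continuous (R : realType) (f : R -> R) (s d : R) :
  is_derive s 1 f d -> {for s, continuous f}.
Proof. by move=> [fs _]; exact/differentiable_continuous/derivable1_diffP. Qed.

Lemma variable_transformation_comp (R : realType) (I J K : set R)
    (phi lam psi mu : R -> R) :
  variable_transformation I J phi lam -> variable_transformation J K psi mu ->
  variable_transformation I K (phi \o psi) (fun s => lam (psi s) * mu s).
Proof.
move=> [bphi dphi] [bpsi dpsi]; split; first exact: set_bij_comp bpsi bphi.
move=> s Ks; have [ds cs ns] := dpsi s Ks.
have [dt ct nt] := dphi _ (set_bij_homo bpsi Ks); split.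
- exact: is_derive1_comp.
- apply: (@continuousM _ _ (lam \o psi) mu); last exact: cs.
  by apply: continuous_comp; [exact: derivable1_continuous ds|exact: ct].
- by rewrite mulf_neq0.
Qed.

(** The inverse function theorem: as lam does not vanish, the inverse bijection
    has derivative 1 / lam(psi t).  Openness of [J] is what makes phi injective
    and continuous in a neighbourhood of each point. *)
Lemma variable_transformation_inv (R : realType) (I J : set R)
    (phi lam : R -> R) :
  open J -> variable_transformation I J phi lam ->
  exists psi mu, variable_transformation J I psi mu.
Proof.
move=> oJ [bphi dphi].
pose psi := 'pinv_(fun=> 0) J phi.
have bpsi : set_bij I J psi by exact: bijpinv_bij.
have phiK x : J x -> psi (phi x) = x.
  by move=> Jx; apply: pinvKV => //; [exact: set_bij_inj bphi|exact: mem_set].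
exists psi, (fun t => (lam (psi t))^-1); split=> // t It.
have Jt : J (psi t) by exact: (set_bij_homo bpsi).
have ptK : phi (psi t) = t.
  by apply: pinvK; apply/mem_set; have [_ _ /(_ _ It)] := bphi.
have [dt ct nt] := dphi _ Jt.
have dpsi : is_derive t 1 psi (lam (psi t))^-1.
  rewrite -[X in is_derive X]ptK; apply: is_derive_inverse => //.
  - by apply: (filterS _ (open_nbhs_nbhs (conj oJ Jt))) => x; exact: phiK.
  - apply: (filterS _ (open_nbhs_nbhs (conj oJ Jt))) => x Jx.
    by have [dx _ _] := dphi _ Jx; exact: derivable1_continuous dx.
split; [exact: dpsi| |by rewrite invr_eq0].
apply: (@continuousV _ _ (lam \o psi)); first exact: nt.
by apply: continuous_comp; [exact: derivable1_continuous dpsi|exact: ct].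
Qed.

Lemma open_intervalP (R : realType) (I : set R) : open_interval I ->
  [\/ I = setT, exists a, I = [set r | a < r], exists b, I = [set r | r < b] |
      exists a b, a < b /\ I = [set r | a < r < b]].
Proof.
move=> [oI iI [x Ix]].
have iE : I° = I by move: oI => /interior_id.
case: (pselect (has_lbound I)) => hl; case: (pselect (has_ubound I)) => hu.
- have E := interval_bounded_interior iI hl hu; rewrite iE in E.
  constructor 4; exists (inf I), (sup I); split => //.
  by move: Ix; rewrite {1}E /= => /andP[]; exact: lt_trans.
- have E := interval_right_unbounded_interior iI hl hu; rewrite iE in E.
  by constructor 2; exists (inf I).
- have E := interval_left_unbounded_interior iI hl hu; rewrite iE in E.
  by constructor 3; exists (sup I).
- by constructor 1; exact: interval_unbounded_setT.
Qed.

Lemma open_interval_to_half_line (R : realType) (J : set R) :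
  open_interval J ->
  exists phi lam, variable_transformation [set r : R | 0 < r] J phi lam.
Proof.
move=> /open_intervalP[->|[a ->]|[b ->]|[a [b [ab ->]]]].
- exists expR, expR; split.
    apply: (@set_bij_can _ _ _ _ _ (@ln R)) => //= x.
    + by rewrite expR_gt0.
    + by rewrite expRK.
    + by move=> x0; rewrite lnK.
  by move=> s _; split; [exact: is_derive_expR|exact: continuous_expR|
    rewrite gt_eqF ?expR_gt0].
- exists (fun s => s - a), (fun=> 1); split.
    by apply: (@set_bij_can _ _ _ _ _ (fun t => t + a)) => /= x *; lra.
  move=> s _; split; [|exact: cst_continuous|exact: oner_neq0].
  by apply: is_derive_eq; rewrite subr0.
- exists (fun s => b - s), (fun=> -1); split.
    by apply: (@set_bij_can _ _ _ _ _ (fun t => b - t)) => /= x *; lra.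
  move=> s _; split; [|exact: cst_continuous|by rewrite oppr_eq0 oner_neq0].
  by apply: is_derive_eq; rewrite add0r mul1r.
- (* The homography sending a to 0 and b to infinity. *)
  exists (fun s => (s - a) * (b - s)^-1),
    (fun s => (b - a) * ((b - s)^-1 * (b - s)^-1)).
  split.
    apply: (@set_bij_can _ _ _ _ _ (fun t => (a + b * t) / (1 + t))) => /= x.
    + by move=> /andP[ax xb]; rewrite divr_gt0 ?subr_gt0.
    + move=> x0; have x1 : 0 < 1 + x by lra.
      by rewrite ltr_pdivlMr// ltr_pdivrMr//; apply/andP; split; nra.
    + move=> /andP[ax xb]; have h : b - x != 0 by apply/eqP; lra.
      by field; apply/andP; split; apply/eqP; lra.
    + move=> x0; have h : 1 + x != 0 by apply/eqP; lra.
      by field; apply/andP; split; apply/eqP; lra.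
  move=> s /= /andP[sa sb]; have h : b - s != 0 by apply/eqP; lra.
  have h2 : b - a != 0 by apply/eqP; lra.
  have dV : is_derive s 1 (fun s => (b - s)^-1) ((b - s)^-1 * (b - s)^-1).
    apply: is_derive_eq; rewrite /GRing.scale/=.
    by field; exact: h.
  split.
  + by apply: is_derive_eq; rewrite /GRing.scale/=; field; exact: h.
  + apply: (@continuousM _ _ (fun=> b - a)); first exact: cst_continuous.
    by apply: (@continuousM _ _ (fun s => (b - s)^-1));
      exact: derivable1_continuous dV.
  + by rewrite !mulf_neq0 ?invr_eq0.
Qed.

(** The half line serves as an intermediate, which leaves four cases to treat
    instead of sixteen. *)
Lemma open_interval_transformation (R : realType) (I J : set R) :
  open_interval I -> open_interval J ->
  exists phi lam, variable_transformation I J phi lam.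
Proof.
move=> oI oJ.
have [f [df Hf]] := open_interval_to_half_line oI.
have [g [dg Hg]] := open_interval_to_half_line oJ.
have [k [dk Hk]] : exists k dk, variable_transformation I [set r | 0 < r] k dk.
  by apply: variable_transformation_inv Hf; have [] := oI.
by eexists; eexists; exact: variable_transformation_comp Hk Hg.
Qed.

(** * Derivatives of vector-valued functions *)

Lemma mulmxr_continuous (R : realType) (m n : nat) (M : 'M[R]_(m.+1, n.+1)) :
  continuous (mulmxr M : 'rV[R]_m.+1 -> 'rV[R]_n.+1).
Proof.
have -> : (mulmxr M : 'rV[R]_m.+1 -> 'rV[R]_n.+1) =
    fun v => \sum_i v 0 i *: row i M.
  by apply/funext => v /=; rewrite mulmx_sum_row.
apply: continuous_big => [|i _ x]; first exact: add_continuous.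
by apply: (@cvgZr_tmp _ _ _ (nbhs x)); exact: coord_continuous.
Qed.

Lemma is_derive_mulmxr (R : realType) (m n : nat) (M : 'M[R]_(m.+1, n.+1))
    (f : R -> 'rV[R]_m.+1) (s : R) (df : 'rV[R]_m.+1) :
  is_derive s 1 f df -> is_derive s 1 (fun t => f t *m M) (df *m M).
Proof.
move=> [/derivable1_diffP fs <-].
have Ls x : differentiable (mulmxr M : 'rV[R]_m.+1 -> 'rV[R]_n.+1) x.
  exact/linear_differentiable/mulmxr_continuous.
have dfs : differentiable (mulmxr M \o f) s by exact: differentiable_comp.
apply: DeriveDef; first exact/derivable1_diffP.
have -> : (fun t => f t *m M) = mulmxr M \o f by [].
rewrite deriveE// diff_comp//= diff_lin; last exact: mulmxr_continuous.
by rewrite deriveE.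
Qed.

(** The mean value theorem fails for vector-valued functions, so it is applied
    to each coordinate.  It is applied between two points of [I] only, because
    nothing is known of [f] outside [I]. *)
Lemma is_derive0_cst (R : realType) (n : nat) (I : set R)
    (f : R -> 'rV[R]_n.+1) :
  is_interval I -> (forall s, I s -> is_derive s 1 f 0) ->
  forall s t, I s -> I t -> f s = f t.
Proof.
move=> iI df s t.
wlog st : s t / s <= t => [H Is It|Is It].
  by case: (leP s t) => [|/ltW] st; [exact: H|exact/esym/H].
apply/rowP => j.
have dfj u : I u -> is_derive u 1 (fun x => f x 0 j) 0.
  move=> /df [fu Dfu]; apply: DeriveDef; first exact: (derivable_mxP _ _ _).1 fu 0 j.
  by move: (derive_mx fu); rewrite Dfu => /rowP/(_ j); rewrite !mxE.
have Ist u : u \in `[s, t] -> I u.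
  by rewrite in_itv; exact: iI Is It u.
have [u||_ _] := @MVT_segment _ (fun x => f x 0 j) (fun=> 0) s t st.
- by move=> ust; apply/dfj/Ist/subset_itv_oo_cc.
- apply: derivable_within_continuous => u ust.
  by have [] := dfj _ (Ist _ ust).
by rewrite mul0r => /eqP; rewrite subr_eq0 => /eqP.
Qed.

(** * The Lorentz form and its isometries *)

Definition metric (R : realType) : 'M[R]_3 :=
  diag_mx (\row_j nth 0 [:: -1; 1; 1] j).

Lemma lorentzE (R : realType) (x y : 'rV[R]_3) :
  lorentz x y = (x *m metric R *m y^T) 0 0.
Proof.
rewrite /lorentz mul_mx_diag mxE !big_ord_recl big_ord0 !mxE /= addr0.
rewrite mulrN1 mulNr !mulr1 addrA.
by congr (_ + _ * _ + _ * _); congr (_ _ _); apply: val_inj.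
Qed.

Lemma lorentzC (R : realType) (x y : 'rV[R]_3) : lorentz x y = lorentz y x.
Proof. by rewrite /lorentz; congr (- _ + _ + _); rewrite mulrC. Qed.

Lemma metricK (R : realType) : metric R *m metric R = 1%:M.
Proof.
rewrite mulmx_diag -diag_const_mx; congr diag_mx.
by apply/rowP => j; rewrite !mxE; case: j => [[|[|[]]]]//= _; rewrite ?mulrNN mulr1.
Qed.

Lemma gram_lorentz (R : realType) (F : 'M[R]_3) i j :
  (F *m metric R *m F^T) i j = lorentz (row i F) (row j F).
Proof.
rewrite lorentzE tr_row -row_mul [LHS]mxE [RHS]mxE.
by apply: eq_bigr => k _; rewrite [row _ _ _ _]mxE [col _ _ _ _]mxE.
Qed.

(** A bilinear form is determined by its values on the standard basis. *)
Lemma lorentz_isometryP (R : realType) (M : 'M[R]_3) :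
  lorentz_isometry M <-> M *m metric R *m M^T = metric R.
Proof.
split=> [isoM|MGM x y].
  apply/matrixP => i j; rewrite gram_lorentz !rowE isoM -!row1 -gram_lorentz.
  by rewrite trmx1 mul1mx mulmx1.
by rewrite !lorentzE trmx_mul !mulmxA -(mulmxA x) -(mulmxA x) MGM.
Qed.

(** Isometries are invertible because the Lorentz form is nondegenerate. *)
Lemma lorentz_isometry_unit (R : realType) (M : 'M[R]_3) :
  lorentz_isometry M -> M \in unitmx.
Proof.
move=> /lorentz_isometryP MGM.
have : M *m (metric R *m M^T *m metric R) = 1%:M by rewrite !mulmxA MGM metricK.
by move/mulmx1_unit => [].
Qed.

(** Two bases, the rows of [F] and of [F'], with the same Gram matrix [D] are
    exchanged by an isometry, since a bilinear form is determined by its Gram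
    matrix in a basis.  For an orthonormal basis, D^2 = 1, so that F^-1 is the
    explicit matrix G F^T D with G the metric; in particular invertibility of
    [F] follows from the Gram equation. *)
Lemma gram_isometry (R : realType) (D F F' : 'M[R]_3) :
  D *m D = 1%:M -> F *m metric R *m F^T = D -> F' *m metric R *m F'^T = D ->
  exists2 M, lorentz_isometry M & F *m M = F'.
Proof.
move=> DD FD F'D; pose V := metric R *m F^T *m D.
have FV : F *m V = 1%:M by rewrite !mulmxA FD.
have VF : V *m F = 1%:M by exact: mulmx1C.
exists (V *m F'); last by rewrite mulmxA FV mul1mx.
apply/lorentz_isometryP; rewrite trmx_mul !mulmxA -2!(mulmxA V) F'D.
rewrite -FD !mulmxA VF mul1mx.
by rewrite -mulmxA -trmx_mul VF trmx1 mulmx1.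
Qed.

(** * Moving a timelike ruled surface *)

Lemma derive1_motion (R : realType) (m n : nat) (M : 'M[R]_(m.+1, n.+1))
    (b : 'rV[R]_n.+1) (f : R -> 'rV[R]_m.+1) (s : R) : derivable f s 1 ->
  is_derive s 1 (fun t => f t *m M + b) (derive1 f s *m M).
Proof.
move=> fs; rewrite derive1E.
have dM : is_derive s 1 (fun t => f t *m M) ('D_1 f s *m M).
  by apply: is_derive_mulmxr; exact: DeriveDef.
by have := is_deriveD dM (is_derive_cst b s 1); rewrite addr0.
Qed.

Lemma near_eq_continuous_at (T U : topologicalType) (f g : T -> U) (x : T) :
  (\near x, f x = g x) -> {for x, continuous f} -> {for x, continuous g}.
Proof.
move=> fg; rewrite /prop_for /continuous_at -(nbhs_singleton fg).
by move=> fx; apply: cvg_trans fx; exact: near_eq_cvg.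
Qed.

(** Derivatives of the moved curves are the images of the derivatives by the
    linear part M, so that every condition expressed by scalar products is
    preserved since M is an isometry, and regularity is preserved since M is
    invertible. *)
Lemma move_timelike (R : realType) (M : 'M[R]_3) (b : 'rV[R]_3)
    (S : ruled_data R) : lorentz_isometry M -> timelike_ruled_surface S ->
  timelike_ruled_surface (move M b S).
Proof.
move=> isoM [[oI iI neI] cC1 reg str frame frenet curv].
have dc s : dom S s ->
    is_derive s 1 (striction (move M b S)) (derive1 (striction S) s *m M).
  by move=> Ss; have [ds _] := cC1 s Ss; exact: derive1_motion.
have dcE s : dom S s ->
    derive1 (striction (move M b S)) s = derive1 (striction S) s *m M.
  by move=> /dc ds; rewrite [LHS]derive1E derive_val.
have dqE s : dom S s ->
    derive1 (ruling (move M b S)) s = derive1 (ruling S) s *m M.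
  move=> Ss; have [ds _ _] := frenet s Ss; rewrite [LHS]derive1E derive1E.
  by have dM := is_derive_mulmxr M ds; rewrite !derive_val.
split.
- by split; [exact: oI|exact: iI|exact: neI].
- move=> s Ss; split; first by have [] := dc s Ss.
  have [_ cs] := cC1 s Ss.
  have cM : {for s, continuous (mulmxr M \o derive1 (striction S))}.
    by apply: continuous_comp; [exact: cs|exact: mulmxr_continuous].
  (* The two derivatives are known to agree on dom S only, which is a
     neighbourhood of s. *)
  apply: near_eq_continuous_at cM.
  by apply: (filterS _ (open_nbhs_nbhs (conj oI Ss))) => t St /=; rewrite dcE.
- move=> s v Ss.
  have [ds _] := cC1 s Ss; have [[dq _] _ _] := frenet s Ss.
  have surfaceE x y : surface (move M b S) x y = surface S x y *m M + b.
    by rewrite /surface /= mulmxDl -scalemxAl addrAC.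
  have dx : derivable (fun x => surface S x v) s 1.
    by apply: derivableD; [exact: ds|exact: derivableZ].
  have {}dx := derive1_motion M b dx.
  have dy : derivable (fun y => surface S s y) v 1.
    by apply/derivable1_diffP/differentiableD.
  have {}dy := derive1_motion M b dy.
  rewrite (eq_fun (fun x => surfaceE x v)) (eq_fun (surfaceE s)) !derive1E.
  have Mfree : row_free M by rewrite row_free_unit lorentz_isometry_unit.
  rewrite !derive_val -mul_col_mx /row_free mxrankMfree; last exact: Mfree.
  exact: reg.
- move=> s Ss /=; have [h1 h2 h3] := str s Ss.
  by rewrite (dcE _ Ss) (dqE _ Ss) !isoM.
- by move=> s Ss /=; rewrite !isoM; exact: frame.
- move=> s Ss /=; have [dq dh da] := frenet s Ss.
  split; rewrite !scalemxAl -?mulmxDl; exact: is_derive_mulmxr.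
- exact: curv.
Qed.

(** * Cylindrical surfaces *)

Definition frame (R : realType) (S : ruled_data R) (s : R) : 'M[R]_3 :=
  \matrix_(i < 3)
    nth 0 [:: ruling S s; central_normal S s; asymptotic_normal S s] i.

Lemma gram_frame (R : realType) (S : ruled_data R) (s : R) :
  timelike_frame S -> dom S s ->
  frame S s *m metric R *m (frame S s)^T =
    diag_mx (\row_j nth 0 [:: eps R (rtype S); 1; - eps R (rtype S)] j).
Proof.
move=> /(_ s) /[apply] /= -[[qq hh aa] [qh qa ha]].
apply/matrixP => i j; rewrite gram_lorentz !rowK !mxE.
by case: i => [[|[|[|//]]] ?]; case: j => [[|[|[|//]]] ?];
  rewrite /= ?mulr1n ?mulr0n // lorentzC.
Qed.

Lemma cylindrical_ruling (R : realType) (S : ruled_data R) (s t : R) :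
  timelike_ruled_surface S -> cylindrical S -> dom S s -> dom S t ->
  ruling S s = ruling S t.
Proof.
move=> hS cyl; have [_ iI _] := trs_dom hS.
apply: is_derive0_cst iI _ _ _ => u Su.
by have [+ _ _] := trs_frenet hS Su; rewrite cyl// scale0r.
Qed.

Theorem corollary4p1 (R : realType) (A B : ruled_data R)
    (hA : timelike_ruled_surface A) (hB : timelike_ruled_surface B)
    (same_type : rtype A = rtype B)
    (cylA : cylindrical A) (cylB : cylindrical B) :
  exists (M : 'M[R]_3) (b : 'rV[R]_3),
    lorentz_isometry M /\ timelike_similar (move M b A) B.
Proof.
have [_ _ [s0 As0]] := trs_dom hA.
have [_ _ [t0 Bt0]] := trs_dom hB.
have gA := gram_frame (trs_frame hA) As0.
have gB := gram_frame (trs_frame hB) Bt0.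
rewrite same_type in gA.
have [|M isoM FM] := gram_isometry _ gA gB.
  rewrite mulmx_diag -diag_const_mx; congr diag_mx; apply/rowP => j; rewrite !mxE.
  by case: (rtype B); case: j => [[|[|[]]]] //= _; rewrite ?mulrNN ?mulr1.
have qM : ruling A s0 *m M = ruling B t0.
  by move/(congr1 (row 0)): FM; rewrite row_mul !rowK.
have [phi [lam Hphi]] := open_interval_transformation (trs_dom hA) (trs_dom hB).
exists M, 0; split; first exact: isoM.
split; [exact: move_timelike|exact: hB|exact: same_type|].
exists phi, lam; split; first exact: Hphi.
move=> s Bs /=.
have Aphi : dom A (phi s) by have [bphi _] := Hphi; exact: (set_bij_homo bphi).
rewrite (cylindrical_ruling hA cylA Aphi As0) qM.
exact: cylindrical_ruling.
Qed.
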